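(* For each conditional probability term $p(x_t=i\mid x_{1:t-1};\boldsymbol\theta,\mathbf w)=\mathrm{Softmax}(i,\mathbf w,h_t)$ of the language model described in the context, writing $h$ for $h_t$, the optimization of the adversarial perturbation in the adversarial maximum likelihood problem (described in the context) is formulated as $$\min_{\{\delta_j\}_{j\in\mathcal V}} \frac{\exp((w_i+\delta_i)^\top h)}{\sum_{j}\exp((w_j+\delta_j)^\top h)}\quad\text{s.t. } \|\delta_j\|\le \epsilon/2,\ \ \forall j\in\mathcal V .$$ This is equivalent to just adding an adversarial perturbation on $w_i$ with magnitude $\epsilon$: $$\min_{\delta_i} \frac{\exp((w_i+\delta_i)^\top h)}{\exp((w_i+\delta_i)^\top h)+\sum_{j\ne i}\exp(w_j^\top h)}\quad\text{s.t. } \|\delta_i\|\le\epsilon ,$$ which is further equivalent to $$\delta_i^*=\arg\min_{\|\delta_i\|\le\epsilon}(w_i+\delta_i)^\top h=-\epsilon\, h/\|h\| .$$ As a result, $$\mathrm{AdvSoft}_\epsilon(i,\mathbf w,h):=\min_{\|\delta_i\|\le\epsilon}\mathrm{Softmax}(i,\{w_i+\delta_i,\,w_{\neg i}\},h)=\frac{\exp(w_i^\top h-\epsilon\|h\|)}{\exp(w_i^\top h-\epsilon\|h\|)+\sum_{j\ne i}\exp(w_j^\top h)},$$ where $w_{\neg i}=\{w_j: j\neq i\}$.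
   Context: $\|\cdot\|$ denotes the $L^2$ (Euclidean) norm. $\mathcal V$ is the vocabulary set, and $\mathbf w=\{w_j\}_{j\in\mathcal V}\subset\mathbb R^d$ are the output embedding vectors of the words. For a sentence $x_{1:T}=[x_1,\dots,x_T]$ with $x_t\in\mathcal V$, the context $x_{1:t-1}$ is represented by a hidden state vector $h_t\in\mathbb R^d$ defined recursively by $h_t=f(x_{t-1},h_{t-1};\boldsymbol\theta)$, where $f$ is a nonlinear map with trainable parameter $\boldsymbol\theta$. The model's conditional probabilities are $$p(x_t\mid x_{1:t-1};\boldsymbol\theta,\mathbf w)=\mathrm{Softmax}(x_t,\mathbf w,h_t),\qquad \mathrm{Softmax}(i,\mathbf w,h):=\frac{\exp(w_i^\top h)}{\sum_{\ell\in\mathcal V}\exp(w_\ell^\top h)} .$$ The notation $\{w_i+\delta_i,w_{\neg i}\}$ denotes the family obtained from $\mathbf w$ by replacing $w_i$ with $w_i+\delta_i$ and leaving the other vectors unchanged. The adversarial maximum likelihood problem, for a given set of training sentences $\{x^\ell_{1:T}\}_\ell$, is $$\max_{\boldsymbol\theta,\mathbf w}\ \min_{\{\delta_{j;t,\ell}\}}\ \sum_{t,\ell}\log p\big(x_t^\ell\mid x_{1:t-1}^\ell;\boldsymbol\theta,\{w_j+\delta_{j;t,\ell}\}\big)\quad\text{s.t. }\|\delta_{j;t,\ell}\|\le\epsilon/2,\ \forall j,t,\ell,$$ where $\delta_{j;t,\ell}$ is an adversarial perturbation applied to the embedding vector $w_j$ of word $j\in\mathcal V$ in the $\ell$-th sentence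 at the $t$-th location, and $\epsilon$ controls the magnitude of the adversarial perturbation. In the claim, the indices $t,\ell$ of the perturbation are dropped because a single term is considered, with the model parameters fixed. *)

(* Defs.v *)
From mathcomp Require Import all_boot all_order all_algebra.
From mathcomp Require Import all_classical all_reals all_analysis.

Set Implicit Arguments.
Unset Strict Implicit.
Unset Printing Implicit Defensive.

Import Order.TTheory GRing.Theory Num.Theory.

Local Open Scope classical_set_scope.
Local Open Scope ring_scope.

Section Optimization.
Context {R : realType} {X : Type}.

Definition is_argmin (D : set X) (g : X -> R) (x : X) : Prop :=
  D x /\ forall y, D y -> g x <= g y.

Definition is_min (D : set X) (g : X -> R) (m : R) : Prop :=
  exists2 x, is_argmin D g x & g x = m.

End Optimization.

Section Euclidean.
Context {R : realType} {d : nat}.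

Definition dotv (u v : 'cV[R]_d) : R := (u^T *m v) 0 0.

(* The norm `|u| that MathComp-Analysis puts on matrices is the sup norm,
   hence this separate Euclidean norm. *)
Definition norm2 (u : 'cV[R]_d) : R := Num.sqrt (\sum_k u k 0 ^+ 2).

Definition ball2 (r : R) : set 'cV[R]_d := [set u | norm2 u <= r].

End Euclidean.

Section LanguageModel.
Context {R : realType} {d : nat} {V : finType} {Theta : Type}.
Implicit Types (w : V -> 'cV[R]_d) (h : 'cV[R]_d) (i : V).

Definition softmax i w h : R :=
  expR (dotv (w i) h) / \sum_l expR (dotv (w l) h).

(* h_t for the context c = [x_1, ..., x_(t-1)]; h1 is the state of the empty
   context. *)
Definition hidden_state (f : V -> 'cV[R]_d -> Theta -> 'cV[R]_d)
    (h1 : 'cV[R]_d) (theta : Theta) (c : seq V) : 'cV[R]_d :=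
  foldl (fun h v => f v h theta) h1 c.

Definition cond_prob (f : V -> 'cV[R]_d -> Theta -> 'cV[R]_d)
    (h1 : 'cV[R]_d) (theta : Theta) w i (c : seq V) : R :=
  softmax i w (hidden_state f h1 theta c).

End LanguageModel.

Section Adversarial.
Context {R : realType} {d : nat} {V : finType}.
Implicit Types (w : V -> 'cV[R]_d) (h : 'cV[R]_d) (i : V) (eps : R).

(* delta l t j perturbs the embedding of the word j at location t of the
   l-th sentence; locations are numbered from 0, so that the context of
   location t consists of the first t words. *)
Definition adv_loglik (Theta : Type)
    (f : V -> 'cV[R]_d -> Theta -> 'cV[R]_d) (h1 : 'cV[R]_d) (theta : Theta)
    w (L T : nat) (x : 'I_L -> T.-tuple V)
    (delta : 'I_L -> 'I_T -> V -> 'cV[R]_d) : R :=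
  \sum_(l < L) \sum_(t < T)
    ln (cond_prob f h1 theta (fun j => w j + delta l t j)
          (tnth (x l) t) (take t (x l))).

Definition adv_feasible eps (L T : nat) :
    set ('I_L -> 'I_T -> V -> 'cV[R]_d) :=
  [set delta | forall l t j, norm2 (delta l t j) <= eps / 2].

Definition joint_feasible eps : set (V -> 'cV[R]_d) :=
  [set delta | forall j, norm2 (delta j) <= eps / 2].

Definition joint_obj i w h (delta : V -> 'cV[R]_d) : R :=
  expR (dotv (w i + delta i) h) / \sum_j expR (dotv (w j + delta j) h).

Definition single_obj i w h (delta : 'cV[R]_d) : R :=
  expR (dotv (w i + delta) h) /
  (expR (dotv (w i + delta) h) + \sum_(j | j != i) expR (dotv (w j) h)).

Definition linear_obj i w h (delta : 'cV[R]_d) : R := dotv (w i + delta) h.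

Definition shift_at i w (delta : 'cV[R]_d) : V -> 'cV[R]_d :=
  fun j => if j == i then w i + delta else w j.

(* The minimum of the set, provided it is attained. *)
Definition adv_soft eps i w h : R :=
  inf [set softmax i (shift_at i w delta) h | delta in ball2 eps].

End Adversarial.

(* Main.v *)
(** Every softmax in play is [1 / (1 + sum_(j <> i) exp (m_j))], where [m_j] is
    the inner product with [h] of the difference of the perturbed embeddings of
    [j] and [i]. By Cauchy-Schwarz each perturbation, joint or single, raises
    [m_j] by at most [eps |h|], and one perturbation reaches this bound for all
    [j] at once. Both problems thus have the same minimal value, and their
    minimizers are the perturbations that reach the bound for every [j <> i]. *)

Require Import Defs.
From mathcomp Require Import all_boot all_order all_algebra.
From mathcomp Require Import ring lra.
From mathcomp Require Import all_classical all_reals all_analysis.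

Set Implicit Arguments.
Unset Strict Implicit.
Unset Printing Implicit Defensive.

Import Order.TTheory GRing.Theory Num.Theory.

Local Open Scope classical_set_scope.
Local Open Scope ring_scope.

(** * Minimization against a known lower bound that is attained *)

Section Argmin.
Context {R : realType} {X : Type}.
Variables (D : set X) (g : X -> R) (m : R).
Hypothesis m_le : forall x, D x -> m <= g x.
Hypothesis m_attained : exists2 x, D x & g x = m.

Lemma is_argmin_attainedE x : is_argmin D g x <-> D x /\ g x = m.
Proof.
split=> [[Dx gx_le]|[Dx gxm]]; last by split=> // y /m_le; rewrite gxm.
split=> //; apply/le_anti; rewrite m_le // andbT.
by have [y Dy <-] := m_attained; apply: gx_le.
Qed.

Lemma is_min_attainedE m' : is_min D g m' <-> m' = m.
Proof.
split=> [[x /is_argmin_attainedE [_ ->]]//|->].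
by have [x Dx gxm] := m_attained; exists x => //; apply/is_argmin_attainedE.
Qed.

Lemma inf_attainedE : inf [set g x | x in D] = m.
Proof.
have [x Dx gxm] := m_attained; apply/le_anti/andP; split.
  rewrite -gxm; apply: ge_inf; last by exists x.
  by exists m => _ [y Dy <-]; apply: m_le.
apply: lb_le_inf; first by exists (g x), x.
by move=> _ [y Dy <-]; apply: m_le.
Qed.

End Argmin.

(** * Euclidean geometry: Cauchy-Schwarz and linear forms on balls *)

Section EuclideanTheory.
Context {R : realType} {d : nat}.
Implicit Types (u v h : 'cV[R]_d) (eps : R).

Lemma dotvE u v : dotv u v = \sum_k u k 0 * v k 0.
Proof. by rewrite /dotv mxE; apply: eq_bigr => k _; rewrite mxE. Qed.

Lemma dotvC u v : dotv u v = dotv v u.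
Proof. by rewrite !dotvE; apply: eq_bigr => k _; rewrite mulrC. Qed.

Lemma dotvDl u v h : dotv (u + v) h = dotv u h + dotv v h.
Proof. by rewrite /dotv linearD mulmxDl mxE. Qed.

Lemma dotvZl a u h : dotv (a *: u) h = a * dotv u h.
Proof. by rewrite /dotv linearZ /= -scalemxAl mxE. Qed.

Lemma dotvNl u h : dotv (- u) h = - dotv u h.
Proof. by rewrite -scaleN1r dotvZl mulN1r. Qed.

Lemma dotvBl u v h : dotv (u - v) h = dotv u h - dotv v h.
Proof. by rewrite dotvDl dotvNl. Qed.

Lemma norm2_ge0 u : 0 <= norm2 u.
Proof. exact: sqrtr_ge0. Qed.

Lemma dotvv u : dotv u u = norm2 u ^+ 2.
Proof.
rewrite /norm2 sqr_sqrtr; last by apply: sumr_ge0 => k _; apply: sqr_ge0.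
by rewrite dotvE; apply: eq_bigr => k _; rewrite expr2.
Qed.

Lemma norm2_eq0 u : (norm2 u == 0) = (u == 0).
Proof.
apply/eqP/eqP => [u0|->]; last first.
  by rewrite /norm2 big1 ?sqrtr0 // => k _; rewrite mxE expr0n.
have : \sum_k u k 0 ^+ 2 = 0.
  transitivity (dotv u u); last by rewrite dotvv u0 expr0n.
  by rewrite dotvE; apply: eq_bigr => k _; rewrite expr2.
move/(psumr_eq0P (fun k _ => sqr_ge0 (u k 0))) => sq0; apply/colP => k.
by rewrite mxE; apply/eqP; rewrite -(sqrf_eq0 (u k 0)) sq0.
Qed.

Lemma dotv_le u v : dotv u v <= norm2 u * norm2 v.
Proof.
have [->|u0] := eqVneq u 0.
  by rewrite -(scale0r 0) dotvZl mul0r mulr_ge0 ?norm2_ge0.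
have [->|v0] := eqVneq v 0.
  by rewrite dotvC -(scale0r 0) dotvZl mul0r mulr_ge0 ?norm2_ge0.
have a0 : 0 < norm2 u by rewrite lt_def norm2_eq0 u0 norm2_ge0.
have b0 : 0 < norm2 v by rewrite lt_def norm2_eq0 v0 norm2_ge0.
(* With [a = |u|], [b = |v|] and [p = dotv u v], this square expands to [2 a b (a b - p)]; the
   positive factor [a b] is then cancelled. *)
have := sqr_ge0 (norm2 (norm2 v *: u - norm2 u *: v)).
rewrite -dotvv dotvBl !dotvZl !(dotvC _ (_ - _)) !dotvBl !dotvZl !dotvv (dotvC v u).
set a := norm2 u in a0 *; set b := norm2 v in b0 *; set p := dotv u v => H.
have {}H : 0 <= (a * b) * (a * b - p) by nra.
by rewrite -subr_ge0 -(pmulr_rge0 _ (mulr_gt0 a0 b0)).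
Qed.

Lemma norm2N u : norm2 (- u) = norm2 u.
Proof. by rewrite /norm2; under eq_bigr do rewrite mxE sqrrN. Qed.

Lemma norm2Z a u : norm2 (a *: u) = `|a| * norm2 u.
Proof.
apply/eqP; rewrite -(eqrXn2 (ltn0Sn 1)) ?norm2_ge0 ?mulr_ge0 ?norm2_ge0 //.
by rewrite -dotvv dotvZl dotvC dotvZl dotvv exprMn real_normK ?num_real // mulrA expr2.
Qed.

Lemma norm2B u v : norm2 (u - v) <= norm2 u + norm2 v.
Proof.
rewrite -(ler_pXn2r (ltn0Sn 1)) ?nnegrE ?addr_ge0 ?norm2_ge0 //.
rewrite -dotvv dotvBl !(dotvC _ (_ - _)) !dotvBl !dotvv (dotvC v u).
(* Cauchy-Schwarz for [- u] gives [- p <= a b], hence [a^2 - 2 p + b^2 <= (a + b)^2]. *)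
have := dotv_le (- u) v; rewrite norm2N dotvNl.
by move: (dotv u v) (norm2 u) (norm2 v) => p a b; nra.
Qed.

Lemma dotv_ball2_ge eps u h : ball2 eps u -> - (eps * norm2 h) <= dotv u h.
Proof.
rewrite /ball2 /= => u_le; rewrite lerNl -dotvNl (le_trans (dotv_le _ _)) //.
by rewrite norm2N ler_wpM2r ?norm2_ge0.
Qed.

(** As [0^-1 = 0], this is the zero vector when [h = 0]; for [0 <= eps] it then still lies in the
    ball and reaches the bound, which is [0]. *)
Definition worst_dir eps h : 'cV[R]_d := - (eps *: ((norm2 h)^-1 *: h)).

Lemma worst_dir_half eps h :
  worst_dir (eps / 2) h + worst_dir (eps / 2) h = worst_dir eps h.
Proof. by rewrite /worst_dir -opprD -scalerDl -splitr. Qed.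

Lemma worst_dir_ball2 eps h : 0 <= eps -> ball2 eps (worst_dir eps h).
Proof.
move=> eps0; rewrite /ball2 /= norm2N !norm2Z ger0_norm // ler_piMr //.
rewrite normfV ger0_norm ?norm2_ge0 //.
by have [->|h0] := eqVneq (norm2 h) 0; rewrite ?mulr0 // mulVf.
Qed.

Lemma dotv_worst_dir eps h : dotv (worst_dir eps h) h = - (eps * norm2 h).
Proof.
rewrite dotvNl !dotvZl dotvv.
have [->|h0] := eqVneq (norm2 h) 0; first by rewrite expr0n !mulr0.
by rewrite expr2 mulKf.
Qed.

(* Equality case of Cauchy-Schwarz: the two assumptions force
   |u + eps h / |h| |^2 <= eps^2 - 2 eps^2 + eps^2 = 0. *)
Lemma worst_dir_unique eps u h : h != 0 -> ball2 eps u ->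
  dotv u h = - (eps * norm2 h) -> u = worst_dir eps h.
Proof.
move=> h0; rewrite /ball2 /= => u_le uh.
have n0 : norm2 h != 0 by rewrite norm2_eq0.
apply/eqP; rewrite -subr_eq0 -norm2_eq0 -sqrf_eq0 eq_le sqr_ge0 andbT.
rewrite /worst_dir opprK scalerA -dotvv dotvDl !(dotvC _ (_ + _)) !dotvDl.
rewrite !dotvZl !(dotvC _ (_ *: _)) !dotvZl (dotvC h u) uh !dotvv.
have -> : eps / norm2 h * - (eps * norm2 h) = - eps ^+ 2 by field.
have -> : eps / norm2 h * (eps / norm2 h * norm2 h ^+ 2) = eps ^+ 2 by field.
have := norm2_ge0 u; move: (norm2 u) u_le => a; nra.
Qed.

End EuclideanTheory.

(** * Softmax as a decreasing function of the margins *)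

Section SoftmaxTheory.
Context {R : realType} {d : nat} {V : finType}.
Implicit Types (w : V -> 'cV[R]_d) (h : 'cV[R]_d) (i : V) (eps : R).

(** Dividing through by [expR (a i)] leaves only the differences [a j - a i], and the result is
    strictly decreasing in each of them. *)
Lemma expR_div_sumE i (a : V -> R) :
  expR (a i) / (expR (a i) + \sum_(j | j != i) expR (a j)) =
  (1 + \sum_(j | j != i) expR (a j - a i))^-1.
Proof.
have e0 : expR (a i) != 0 by rewrite gt_eqF ?expR_gt0.
have -> : \sum_(j | j != i) expR (a j) =
          expR (a i) * \sum_(j | j != i) expR (a j - a i).
  rewrite mulr_sumr; apply: eq_bigr => j _.
  by rewrite -expRD addrC subrK.
by rewrite -{2}[expR (a i)]mulr1 -mulrDr invfM mulrA divff // mul1r.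
Qed.

Lemma softmaxE i w h :
  softmax i w h = (1 + \sum_(j | j != i) expR (dotv (w j - w i) h))^-1.
Proof.
rewrite /softmax (bigD1 i) //= (expR_div_sumE i (fun j => dotv (w j) h)).
by congr (_ + _)^-1; apply: eq_bigr => j _; rewrite dotvBl.
Qed.

Lemma softmax_gt0 i w h : 0 < softmax i w h.
Proof.
by rewrite softmaxE invr_gt0 ltr_pwDl // sumr_ge0 // => j _; apply: expR_ge0.
Qed.

Definition worst_softmax eps i w h : R :=
  expR (dotv (w i) h - eps * norm2 h) /
  (expR (dotv (w i) h - eps * norm2 h) + \sum_(j | j != i) expR (dotv (w j) h)).

Lemma worst_softmaxE eps i w h : worst_softmax eps i w h =
  (1 + \sum_(j | j != i) expR (dotv (w j - w i) h + eps * norm2 h))^-1.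
Proof.
(* Lowering the logit of [i] alone by [eps * norm2 h] raises all the differences by that amount. *)
pose a j := if j == i then dotv (w i) h - eps * norm2 h else dotv (w j) h.
have := expR_div_sumE i a; rewrite /a eqxx /worst_softmax.
rewrite (eq_bigr (fun j => expR (dotv (w j) h))); last by move=> j /negPf ->.
move=> ->; congr (_ + _)^-1; apply: eq_bigr => j /negPf ->.
by rewrite dotvBl opprB addrA addrAC.
Qed.

Variables (eps : R) (i : V) (w w' : V -> 'cV[R]_d) (h : 'cV[R]_d).
Hypothesis margin_le : forall j, j != i ->
  dotv (w' j - w' i) h <= dotv (w j - w i) h + eps * norm2 h.

(** Here [w'] stands for embeddings perturbed in either way: joint and single perturbations both
    enter only through the bound on the margins. *)
Lemma worst_softmax_le : worst_softmax eps i w h <= softmax i w' h.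
Proof.
rewrite worst_softmaxE softmaxE lef_pV2 ?posrE; last first.
- by rewrite ltr_pwDl // sumr_ge0 // => j _; apply: expR_ge0.
- by rewrite ltr_pwDl // sumr_ge0 // => j _; apply: expR_ge0.
by rewrite lerD2l; apply: ler_sum => j ji; rewrite ler_expR margin_le.
Qed.

(** Equal softmax values mean equal sums of exponentials; since the terms are already ordered one by
    one, they agree one by one. *)
Lemma softmax_worstP : softmax i w' h = worst_softmax eps i w h <->
  forall j, j != i -> dotv (w' j - w' i) h = dotv (w j - w i) h + eps * norm2 h.
Proof.
rewrite worst_softmaxE softmaxE; split=> [|E]; last first.
  by congr (_ + _)^-1; apply: eq_bigr => j /E ->.
move=> /invr_inj /addrI /esym/eqP; rewrite -subr_eq0 -sumrB => /eqP /psumr_eq0P E j ji.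
apply/expR_inj/esym/eqP; rewrite -subr_eq0; apply/eqP/E => // k ki.
by rewrite subr_ge0 ler_expR margin_le.
Qed.

End SoftmaxTheory.

(** * The joint, single and linear problems *)

Section AdversarialTheory.
Context {R : realType} {d : nat} {V : finType}.
Variables (eps : R) (i : V) (w : V -> 'cV[R]_d) (h : 'cV[R]_d).
Hypothesis eps_ge0 : 0 <= eps.

Lemma softmax_shift_at delta :
  softmax i (shift_at i w delta) h = single_obj i w h delta.
Proof.
rewrite /softmax /single_obj (bigD1 i) //= /shift_at eqxx.
by congr (_ / (_ + _)); apply: eq_bigr => j /negPf ->.
Qed.

(** The joint perturbation acts through [delta i - delta j], which takes the place of the single
    [delta]; this is the link between the two problems. *)
Let joint_margin (delta : V -> 'cV[R]_d) j :
  dotv (w j + delta j - (w i + delta i)) h =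
  dotv (w j - w i) h - dotv (delta i - delta j) h.
Proof. by rewrite !(dotvBl, dotvDl); ring. Qed.

Let single_margin delta j : j != i ->
  dotv (shift_at i w delta j - shift_at i w delta i) h =
  dotv (w j - w i) h - dotv delta h.
Proof. by rewrite /shift_at eqxx => /negPf ->; rewrite !(dotvBl, dotvDl); ring. Qed.

Let marginP (a b c : R) : a - b = a + c <-> b = - c.
Proof. by split=> [/addrI <-|->]; rewrite opprK. Qed.

(** By the triangle inequality two radii [eps / 2] add up to the radius [eps] of the single
    problem. *)
Lemma joint_feasibleB (delta : V -> 'cV[R]_d) j k :
  joint_feasible eps delta -> ball2 eps (delta j - delta k).
Proof.
move=> feas; rewrite /ball2 /= (le_trans (norm2B _ _)) // [leRHS]splitr.
by rewrite lerD.
Qed.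

Let joint_margin_le delta : joint_feasible eps delta -> forall j, j != i ->
  dotv (w j + delta j - (w i + delta i)) h <= dotv (w j - w i) h + eps * norm2 h.
Proof.
move=> feas j _; rewrite joint_margin lerD2l lerNl.
exact/dotv_ball2_ge/joint_feasibleB.
Qed.

Let single_margin_le delta : ball2 eps delta -> forall j, j != i ->
  dotv (shift_at i w delta j - shift_at i w delta i) h
    <= dotv (w j - w i) h + eps * norm2 h.
Proof.
by move=> feas j ji; rewrite single_margin // lerD2l lerNl dotv_ball2_ge.
Qed.

Lemma joint_obj_ge delta : joint_feasible eps delta ->
  worst_softmax eps i w h <= joint_obj i w h delta.
Proof. by move=> /joint_margin_le; apply: worst_softmax_le. Qed.

Lemma joint_obj_worstP delta : joint_feasible eps delta ->
  joint_obj i w h delta = worst_softmax eps i w h <->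
  forall j, j != i -> dotv (delta i - delta j) h = - (eps * norm2 h).
Proof.
move=> /joint_margin_le /softmax_worstP E; apply: (iff_trans E).
by split=> H j ji; move: (H j ji); rewrite joint_margin => /marginP.
Qed.

Lemma joint_obj_attained : exists2 delta, joint_feasible eps delta &
  joint_obj i w h delta = worst_softmax eps i w h.
Proof.
(* Opposite half-size perturbations: every difference [delta i - delta j] with [j != i] equals
   [worst_dir eps h]. *)
pose delta j := if j == i then worst_dir (eps / 2) h else - worst_dir (eps / 2) h.
have feas : joint_feasible eps delta.
  move=> j; have := worst_dir_ball2 h (divr_ge0 eps_ge0 (ler0n R 2)).
  by rewrite /ball2 /= /delta; case: ifP; rewrite ?norm2N.
exists delta => //; apply/joint_obj_worstP => // j /negPf ji.
by rewrite /delta eqxx ji opprK worst_dir_half dotv_worst_dir.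
Qed.

Lemma single_obj_ge delta : ball2 eps delta ->
  worst_softmax eps i w h <= single_obj i w h delta.
Proof.
by rewrite -softmax_shift_at => /single_margin_le; apply: worst_softmax_le.
Qed.

(** The equation does not mention [j]; the quantifier makes it vacuous for a one-word vocabulary,
    where the objective is constant. *)
Lemma single_obj_worstP delta : ball2 eps delta ->
  single_obj i w h delta = worst_softmax eps i w h <->
  forall j, j != i -> dotv delta h = - (eps * norm2 h).
Proof.
rewrite -softmax_shift_at => /single_margin_le /softmax_worstP E.
apply: (iff_trans E).
by split=> H j ji; move: (H j ji); rewrite single_margin // => /marginP.
Qed.

Lemma single_obj_attained : exists2 delta, ball2 eps delta &
  single_obj i w h delta = worst_softmax eps i w h.
Proof.
exists (worst_dir eps h); first exact: worst_dir_ball2.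
apply/single_obj_worstP => [|j _]; first exact: worst_dir_ball2.
exact: dotv_worst_dir.
Qed.

Lemma joint_minP m : is_min (joint_feasible eps) (joint_obj i w h) m <->
  m = worst_softmax eps i w h.
Proof. exact: is_min_attainedE joint_obj_ge joint_obj_attained _. Qed.

Lemma single_minP m : is_min (ball2 eps) (single_obj i w h) m <->
  m = worst_softmax eps i w h.
Proof. exact: is_min_attainedE single_obj_ge single_obj_attained _. Qed.

Lemma joint_argminP delta : is_argmin (joint_feasible eps) (joint_obj i w h) delta <->
  joint_feasible eps delta /\
  forall j, j != i -> dotv (delta i - delta j) h = - (eps * norm2 h).
Proof.
apply: (iff_trans (is_argmin_attainedE joint_obj_ge joint_obj_attained _)).
by split=> -[feas E]; split=> //; apply/joint_obj_worstP.
Qed.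

Lemma single_argminP delta : is_argmin (ball2 eps) (single_obj i w h) delta <->
  ball2 eps delta /\ forall j, j != i -> dotv delta h = - (eps * norm2 h).
Proof.
apply: (iff_trans (is_argmin_attainedE single_obj_ge single_obj_attained _)).
by split=> -[feas E]; split=> //; apply/single_obj_worstP.
Qed.

Lemma linear_argminP delta : is_argmin (ball2 eps) (linear_obj i w h) delta <->
  ball2 eps delta /\ dotv delta h = - (eps * norm2 h).
Proof.
have objE u : linear_obj i w h u = dotv (w i) h + dotv u h by rewrite -dotvDl.
have := @is_argmin_attainedE _ _ (ball2 eps) (linear_obj i w h)
  (dotv (w i) h - eps * norm2 h) _ _ delta.
move=> E; apply: (iff_trans (E _ _)).
- by move=> u u_in; rewrite objE lerD2l dotv_ball2_ge.
- exists (worst_dir eps h); first exact: worst_dir_ball2.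
  by rewrite objE dotv_worst_dir.
by rewrite objE; split=> -[? H]; split=> //; [apply: addrI H|rewrite H].
Qed.

Lemma adv_softE : adv_soft eps i w h = worst_softmax eps i w h.
Proof.
apply: inf_attainedE => [u|]; first by rewrite softmax_shift_at; apply: single_obj_ge.
by have [u ? E] := single_obj_attained; exists u; rewrite ?softmax_shift_at.
Qed.

Lemma adv_soft_is_min :
  is_min (ball2 eps) (fun delta => softmax i (shift_at i w delta) h)
    (adv_soft eps i w h).
Proof.
have -> : (fun delta => softmax i (shift_at i w delta) h) = single_obj i w h.
  by apply/funext => u; apply: softmax_shift_at.
by apply/single_minP; apply: adv_softE.
Qed.

End AdversarialTheory.

(** * Splitting the log-likelihood into independent problems *)

Lemma is_argmin_sum (R : realType) (I : finType) (X : I -> Type)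
    (D : forall k, set (X k)) (g : forall k, X k -> R) (x : forall k, X k) :
  is_argmin [set y | forall k, D k (y k)] (fun y => \sum_k g k (y k)) x <->
  forall k, is_argmin (D k) (g k) (x k).
Proof.
split=> [[Dx x_le] k|x_min]; last first.
  split=> [k|y Dy]; first by have [] := x_min k.
  by apply: ler_sum => k _; have [_] := x_min k; apply.
split=> [|y Dy]; first exact: Dx.
(* The competitor differs from [x] only in coordinate [k], so all the other terms cancel. *)
have := x_le (dfwith x k y); rewrite (bigD1 k) //= [leRHS](bigD1 k) //= dfwithin.
rewrite (eq_bigr (fun j => g j (x j)) (F1 := fun j => g j (dfwith x k y j))).
  rewrite lerD2r; apply=> j.
  by case: dfwithP => [//|? ?]; apply: Dx.
by move=> j jk; rewrite dfwithout // eq_sym.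
Qed.

Lemma is_argmin_ln (R : realType) (X : Type) (D : set X) (g : X -> R) x :
  (forall y, 0 < g y) ->
  is_argmin D (fun y => ln (g y)) x <-> is_argmin D g x.
Proof.
move=> g0; split=> -[Dx x_le]; split=> // y /x_le; rewrite ler_ln ?posrE //.
Qed.

(** The sum separates over sentences, then over locations; monotonicity of [ln] on positive reals
    removes the logarithm from each term. *)
Lemma adv_loglik_argmin (R : realType) (d : nat) (V : finType) (Theta : Type)
  (f : V -> 'cV[R]_d -> Theta -> 'cV[R]_d) (h1 : 'cV[R]_d) (theta : Theta)
  (w : V -> 'cV[R]_d) (eps : R) (L T : nat) (x : 'I_L -> T.-tuple V) delta :
  is_argmin (@adv_feasible R d V eps L T) (adv_loglik f h1 theta w x) delta <->
  forall (l : 'I_L) (t : 'I_T),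
    is_argmin (joint_feasible eps)
      (joint_obj (tnth (x l) t) w (hidden_state f h1 theta (take t (x l))))
      (delta l t).
Proof.
pose obj l t := joint_obj (tnth (x l) t) w (hidden_state f h1 theta (take t (x l))).
apply: (iff_trans (is_argmin_sum
  (fun=> [set y : 'I_T -> V -> 'cV[R]_d | forall t, joint_feasible eps (y t)])
  (fun l y => \sum_t ln (obj l t (y t))) delta)).
have E l : is_argmin
    [set y : 'I_T -> V -> 'cV[R]_d | forall t, joint_feasible eps (y t)]
    (fun y => \sum_t ln (obj l t (y t))) (delta l) <->
  forall t, is_argmin (joint_feasible eps) (obj l t) (delta l t).
  apply: (iff_trans (is_argmin_sum (fun=> joint_feasible eps)
    (fun t y => ln (obj l t y)) (delta l))).
  by split=> H t; move: (H t) => /is_argmin_ln; apply=> y; apply: softmax_gt0.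
by split=> H l; apply/E; apply: H.
Qed.

Theorem theorem3p1 (R : realType) (d : nat) (V : finType) (Theta : Type)
  (f : V -> 'cV[R]_d -> Theta -> 'cV[R]_d) (h1 : 'cV[R]_d) (theta : Theta)
  (w : V -> 'cV[R]_d) (eps : R) (eps_ge0 : 0 <= eps)
  (L T : nat) (x : 'I_L -> T.-tuple V) :
  (* the inner minimization splits into one joint problem per term *)
  (forall delta : 'I_L -> 'I_T -> V -> 'cV[R]_d,
     is_argmin (@adv_feasible R d V eps L T) (adv_loglik f h1 theta w x) delta
     <-> forall (l : 'I_L) (t : 'I_T),
           is_argmin (joint_feasible eps)
             (joint_obj (tnth (x l) t) w
                (hidden_state f h1 theta (take t (x l))))
             (delta l t)) /\
  forall (l : 'I_L) (t : 'I_T) (i : V),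
    let c := take t (x l) in
    let h := hidden_state f h1 theta c in
    (* the term with all embeddings perturbed is the joint objective *)
    (forall delta : V -> 'cV[R]_d,
       cond_prob f h1 theta (fun j => w j + delta j) i c
       = joint_obj i w h delta) /\
    (* joint problem vs. single problem: same minimum *)
    (forall m : R,
       is_min (joint_feasible eps) (joint_obj i w h) m
       <-> is_min (ball2 eps) (single_obj i w h) m) /\
    (* joint problem vs. single problem: corresponding minimizers *)
    (forall delta : V -> 'cV[R]_d, joint_feasible eps delta ->
       (is_argmin (joint_feasible eps) (joint_obj i w h) delta
        <-> forall j, j != i ->
              is_argmin (ball2 eps) (single_obj i w h) (delta i - delta j))) /\
    (* single problem vs. linear problem; a one-word vocabulary makes
       single_obj constant, so there only one implication survives *)
    (forall delta : 'cV[R]_d,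
       is_argmin (ball2 eps) (linear_obj i w h) delta ->
       is_argmin (ball2 eps) (single_obj i w h) delta) /\
    ((1 < #|V|)%N -> forall delta : 'cV[R]_d,
       is_argmin (ball2 eps) (single_obj i w h) delta ->
       is_argmin (ball2 eps) (linear_obj i w h) delta) /\
    (* the unique minimizer; h / |h| is meaningful only for h != 0 *)
    (h != 0 -> forall delta : 'cV[R]_d,
       is_argmin (ball2 eps) (linear_obj i w h) delta
       <-> delta = - (eps *: ((norm2 h)^-1 *: h))) /\
    (* AdvSoft is an attained minimum, with its closed form *)
    is_min (ball2 eps) (fun delta => softmax i (shift_at i w delta) h)
      (adv_soft eps i w h) /\
    adv_soft eps i w h
    = expR (dotv (w i) h - eps * norm2 h) /
      (expR (dotv (w i) h - eps * norm2 h)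
       + \sum_(j | j != i) expR (dotv (w j) h)).
Proof.
split=> [delta|l t i c h]; first exact: adv_loglik_argmin.
split; first by [].
split=> [m|].
  apply: (iff_trans (joint_minP i w h eps_ge0 m)).
  exact: iff_sym (single_minP i w h eps_ge0 m).
split=> [delta feas|].
  apply: (iff_trans (joint_argminP i w h eps_ge0 delta)).
  split=> [[_ E] j ji|E].
    apply/single_argminP => //; split; first exact: joint_feasibleB.
    by move=> _ _; apply: E.
  (* The criterion for [delta i - delta j] holds for every index other than [i]; it is instantiated
     at [j] itself. *)
  by split=> // j ji; have /single_argminP [//|_] := E j ji; apply; exact: ji.
split=> [delta /linear_argminP [//|? E]|].
  by apply/single_argminP => //; split=> // j _.
split=> [V_gt1 delta /single_argminP [//|feas E]|].
  apply/linear_argminP => //; split=> //.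
  (* A second word provides the index [j != i] at which [E] becomes the linear criterion. *)
  move: V_gt1; rewrite (cardD1 i) inE ltnS => /card_gt0P [j].
  by rewrite !inE andbT => /E.
split=> [h0 delta|].
  apply: (iff_trans (linear_argminP i w h eps_ge0 delta)).
  split=> [[]|->]; first exact: worst_dir_unique.
  by split; [apply: worst_dir_ball2|apply: dotv_worst_dir].
by split; [apply: adv_soft_is_min|apply: adv_softE].
Qed.
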